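(* Let $k$ be a commutative ring, let $\mathfrak{g}$ be a Lie subalgebra of a Lie algebra $\Xi$ over $k$, let $\mathfrak{h}$ be a given $\mathfrak{g}$-complement of $\Xi$, and let $r:\mathfrak{h}\to\mathfrak{g}$ be a deformation map of the associated canonical matched pair $(\mathfrak{g},\mathfrak{h},\triangleright,\triangleleft)$. (1) Let $f_r:\mathfrak{h}\to\Xi=\mathfrak{g}\oplus\mathfrak{h}$ be the $k$-linear map defined for any $x\in\mathfrak{h}$ by $f_r(x)=r(x)\oplus x$. Then $\widetilde{\mathfrak{h}}:=\mathrm{Im}(f_r)$ is a $\mathfrak{g}$-complement of $\Xi$. (2) $\mathfrak{h}_r:=\mathfrak{h}$, as a $k$-module, with the new bracket defined for any $x,y\in\mathfrak{h}$ by $$[x,y]_r:=[x,y]+x\triangleleft r(y)-y\triangleleft r(x)$$ is a Lie algebra (called the $r$-deformation of $\mathfrak{h}$). Furthermore, $\mathfrak{h}_r\cong\widetilde{\mathfrak{h}}$ as Lie algebras.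
   Context: All Lie algebras are over a commutative ring $k$. A $\mathfrak{g}$-complement of $\Xi$ is a Lie subalgebra $\mathfrak{h}$ of $\Xi$ such that $\Xi=\mathfrak{g}+\mathfrak{h}$ and $\mathfrak{g}\cap\mathfrak{h}=\{0\}$. A matched pair of Lie algebras $(\mathfrak{g},\mathfrak{h},\triangleright,\triangleleft)$ consists of Lie algebras $\mathfrak{g},\mathfrak{h}$ and $k$-bilinear maps $\triangleright:\mathfrak{h}\times\mathfrak{g}\to\mathfrak{g}$, $\triangleleft:\mathfrak{h}\times\mathfrak{g}\to\mathfrak{h}$ such that for all $a,b\in\mathfrak{g}$, $x,y\in\mathfrak{h}$: $[x,y]\triangleright a=x\triangleright(y\triangleright a)-y\triangleright(x\triangleright a)$; $x\triangleleft[a,b]=(x\triangleleft a)\triangleleft b-(x\triangleleft b)\triangleleft a$; $x\triangleright[a,b]=[x\triangleright a,b]+[a,x\triangleright b]+(x\triangleleft a)\triangleright b-(x\triangleleft b)\triangleright a$; $[x,y]\triangleleft a=[x,y\triangleleft a]+[x\triangleleft a,y]+x\triangleleft(y\triangleright a)-y\triangleleft(x\triangleright a)$. If $\mathfrak{h}$ is a $\mathfrak{g}$-complement of $\Xi$, the associated canonical matched pair is defined by the unique decomposition $[x,a]=x\triangleright a\oplus x\triangleleft a$ in $\Xi=\mathfrak{g}\oplus\mathfrak{h}$, with $x\triangleright a\in\mathfrak{g}$, $x\triangleleft a\in\mathfrak{h}$, for all $a\in\mathfrak{g}$, $x\in\mathfrak{h}$. A deformation map of a matched pair $(\mathfrak{g},\mathfrak{h},\triangleright,\triangleleft)$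 is a $k$-linear map $r:\mathfrak{h}\to\mathfrak{g}$ such that for all $x,y\in\mathfrak{h}$ $$r([x,y])-[r(x),r(y)]=r\bigl(y\triangleleft r(x)-x\triangleleft r(y)\bigr)+x\triangleright r(y)-y\triangleright r(x).$$ *)

(* Defs.v *)
From HB Require Import structures.
From mathcomp Require Import all_boot all_algebra.
From mathcomp Require Import boolp classical_sets.

Set Implicit Arguments.
Unset Strict Implicit.
Unset Printing Implicit Defensive.

Import GRing.Theory.
Local Open Scope ring_scope.
Local Open Scope classical_set_scope.

(* The library's [bilinear_for] requires a nonzero scalar ring; this is the
   same condition over an arbitrary one. *)
Definition bilinear_map (k : comPzRingType) (U V W : lmodType k)
    (f : U -> V -> W) : Prop :=
  (forall v, linear (f ^~ v)) /\ (forall u, linear (f u)).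

Record lie_bracket (k : comPzRingType) (V : lmodType k) (br : V -> V -> V) :
    Prop := LieBracket {
  lie_bracket_bilinear : bilinear_map br;
  lie_bracket_alternating : forall x, br x x = 0;
  lie_bracket_jacobi : forall x y z,
    br x (br y z) + br y (br z x) + br z (br x y) = 0
}.

HB.mixin Record Lmodule_isLieAlgebra (k : comPzRingType) L
    of GRing.Lmodule k L := {
  lie : L -> L -> L;
  lieP : lie_bracket lie
}.

#[short(type="lieAlgType")]
HB.structure Definition LieAlgebra (k : comPzRingType) :=
  {L of GRing.Lmodule k L & Lmodule_isLieAlgebra k L}.

Notation "[ 'lie' x , y ]" := (lie x y)
  (at level 0, x, y at level 99, format "[ 'lie'  x ,  y ]") : ring_scope.

(* A k-module equipped with a given Lie bracket, as a Lie algebra. *)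
Definition lie_on (k : comPzRingType) (V : lmodType k) (br : V -> V -> V)
  (brP : lie_bracket br) : Type := V.
HB.instance Definition _ (k : comPzRingType) (V : lmodType k)
    (br : V -> V -> V) (brP : lie_bracket br) :=
  GRing.Lmodule.copy (lie_on brP) V.
Fact lie_on_bracket (k : comPzRingType) (V : lmodType k) (br : V -> V -> V)
  (brP : lie_bracket br) : @lie_bracket k (lie_on brP) br.
Proof. by case: (brP) => -[bl br'] alt jac; split; [split | |]. Qed.
HB.instance Definition _ (k : comPzRingType) (V : lmodType k)
    (br : V -> V -> V) (brP : lie_bracket br) :=
  Lmodule_isLieAlgebra.Build k (lie_on brP) (lie_on_bracket brP).

Definition lie_isomorphic (k : comPzRingType) (L M : lieAlgType k) : Prop :=
  exists2 f : {linear L -> M}, bijective f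
    & forall x y, f [lie x, y] = [lie f x, f y].

Section Theory.
Variables (k : comPzRingType) (L : lieAlgType k).
Implicit Types x y z : L.

Lemma lie_isbracket : lie_bracket (@lie k L).
Proof. exact: lieP. Qed.

Lemma lieDlZ c x y z : [lie c *: x + y, z] = c *: [lie x, z] + [lie y, z].
Proof. exact: (lie_bracket_bilinear lie_isbracket).1. Qed.

Lemma lieDrZ c x y z : [lie x, c *: y + z] = c *: [lie x, y] + [lie x, z].
Proof. exact: (lie_bracket_bilinear lie_isbracket).2. Qed.

Lemma lieDl x y z : [lie x + y, z] = [lie x, z] + [lie y, z].
Proof.
by have := (lie_bracket_bilinear lie_isbracket).1 z 1 x y; rewrite !scale1r.
Qed.

Lemma lieDr x y z : [lie x, y + z] = [lie x, y] + [lie x, z].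
Proof.
by have := (lie_bracket_bilinear lie_isbracket).2 x 1 y z; rewrite !scale1r.
Qed.

Lemma liexx x : [lie x, x] = 0.
Proof. exact: lie_bracket_alternating lie_isbracket x. Qed.

Lemma lieC x y : [lie x, y] = - [lie y, x].
Proof.
apply/eqP; rewrite -addr_eq0; apply/eqP.
by have := liexx (x + y); rewrite lieDl !lieDr !liexx add0r addr0.
Qed.

Lemma lieNr x y : [lie x, - y] = - [lie x, y].
Proof.
apply/eqP; rewrite -addr_eq0 -lieDr addNr; apply/eqP.
by have := lieDr x 0 0; rewrite addr0 -[LHS]addr0 => /addrI.
Qed.

Lemma lie_jacobil x y z :
  [lie [lie x, y], z] = [lie x, [lie y, z]] - [lie y, [lie x, z]].
Proof.
have /eqP := lie_bracket_jacobi lie_isbracket x y z.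
rewrite [[lie z, [lie x, y]]]lieC (lieC z x) lieNr subr_eq0 => /eqP.
by move=> <-.
Qed.

Lemma lie_jacobir x y z :
  [lie x, [lie y, z]] = [lie [lie x, y], z] - [lie [lie x, z], y].
Proof.
by rewrite lie_jacobil [[lie [lie x, z], y]]lieC opprK subrK.
Qed.

End Theory.

Definition lie_subalgebra (k : comPzRingType) (L : lieAlgType k) (S : set L) :
    Prop :=
  GRing.submod_closed [in S] /\ {in S &, forall x y, [lie x, y] \in S}.

Record lieSubalg (k : comPzRingType) (L : lieAlgType k) := LieSubalg {
  lsa_set : set L;
  lsaP : lie_subalgebra lsa_set
}.

Definition lsa_sort (k : comPzRingType) (L : lieAlgType k) (H : lieSubalg L) :
  Type := {x : L | x \in lsa_set H}.
Coercion lsa_sort : lieSubalg >-> Sortclass.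

Section Subalgebra.
Variables (k : comPzRingType) (L : lieAlgType k) (H : lieSubalg L).

HB.instance Definition _ := SubType.copy (lsa_sort H) {x : L | x \in lsa_set H}.
HB.instance Definition _ := [Choice of (lsa_sort H) by <:].

Fact lsa_submod : GRing.subsemimod_closed [in lsa_set H].
Proof.
have [[H0 Hlin] _] := lsaP H; split; last first.
  by move=> a x Hx; rewrite -[a *: x]addr0; exact: Hlin.
by split=> // x y Hx Hy; rewrite -[x]scale1r; exact: Hlin.
Qed.
HB.instance Definition _ :=
  GRing.SubChoice_isSubLmodule.Build k L _ (lsa_sort H) lsa_submod.

Definition incl (x : lsa_sort H) : L := val x.

Fact incl_linear : linear incl.
Proof. by move=> c x y; rewrite /incl linearP. Qed.
HB.instance Definition _ :=
  GRing.isLinear.Build k (lsa_sort H) L *:%R incl incl_linear.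

Lemma incl_inj : injective incl.
Proof. by move=> x y; exact: val_inj. Qed.

Lemma inclP (x : lsa_sort H) : lsa_set H (incl x).
Proof. exact/set_mem/(valP x). Qed.

Fact lsa_lie_subproof (x y : lsa_sort H) : [lie incl x, incl y] \in lsa_set H.
Proof. by apply: (lsaP H).2; exact/mem_set/inclP. Qed.
Definition lsa_lie (x y : lsa_sort H) : lsa_sort H :=
  Sub [lie incl x, incl y] (lsa_lie_subproof x y).

Fact incl_lsa_lie (x y : lsa_sort H) : incl (lsa_lie x y) = [lie incl x, incl y].
Proof. by []. Qed.

Fact lsa_lie_bracket : lie_bracket lsa_lie.
Proof.
split.
- split=> [z|z] c x y; apply: incl_inj.
    by rewrite linearP !incl_lsa_lie linearP lieDlZ.
  by rewrite linearP !incl_lsa_lie linearP lieDrZ.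
- by move=> x; apply: incl_inj; rewrite linear0 incl_lsa_lie liexx.
- move=> x y z; apply: incl_inj; rewrite linear0 !linearD /= !incl_lsa_lie.
  exact: (lie_bracket_jacobi (lie_isbracket L)).
Qed.
HB.instance Definition _ :=
  Lmodule_isLieAlgebra.Build k (lsa_sort H) lsa_lie_bracket.

Lemma incl_lie (x y : H) : incl [lie x, y] = [lie incl x, incl y].
Proof. by []. Qed.

End Subalgebra.

Definition is_complement (k : comPzRingType) (Xi : lieAlgType k)
    (g h : lieSubalg Xi) : Prop :=
  (forall z : Xi, exists (a : g) (x : h), z = incl a + incl x)
  /\ lsa_set g `&` lsa_set h = [set 0].

Record matched_pair (k : comPzRingType) (g h : lieAlgType k) := MatchedPair {
  lact : h -> g -> g;
  ract : h -> g -> h;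
  lact_bilinear : bilinear_map lact;
  ract_bilinear : bilinear_map ract;
  lact_lie : forall (x y : h) (a : g),
    lact [lie x, y] a = lact x (lact y a) - lact y (lact x a);
  ract_lie : forall (x : h) (a b : g),
    ract x [lie a, b] = ract (ract x a) b - ract (ract x b) a;
  lact_compat : forall (x : h) (a b : g),
    lact x [lie a, b] = [lie lact x a, b] + [lie a, lact x b]
                        + lact (ract x a) b - lact (ract x b) a;
  ract_compat : forall (x y : h) (a : g),
    ract [lie x, y] a = [lie x, ract y a] + [lie ract x a, y]
                        + ract x (lact y a) - ract y (lact x a)
}.

Section CanonicalMatchedPair.
Variables (k : comPzRingType) (Xi : lieAlgType k) (g h : lieSubalg Xi).
Hypothesis gh : is_complement g h.

Fact compl_dec (z : Xi) : exists p : g * h, z = incl p.1 + incl p.2.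
Proof. by have [a [x ->]] := gh.1 z; exists (a, x). Qed.

Definition compl_projg (z : Xi) : g := (projT1 (cid (compl_dec z))).1.
Definition compl_projh (z : Xi) : h := (projT1 (cid (compl_dec z))).2.

Lemma compl_projE (z : Xi) : z = incl (compl_projg z) + incl (compl_projh z).
Proof. exact: projT2 (cid (compl_dec z)). Qed.

Lemma compl_inj (a b : g) (x y : h) :
  incl a + incl x = incl b + incl y -> a = b /\ x = y.
Proof.
move=> e.
have exy : incl (x - y) = incl (b - a).
  apply: (addrI (incl a)).
  by rewrite !linearB /= addrA e addrK [RHS]addrC subrK.
have : (lsa_set g `&` lsa_set h) (incl (b - a)).
  by split; [exact: inclP | rewrite -exy; exact: inclP].
rewrite gh.2 => ba0.
split; last by apply/subr0_eq/incl_inj; rewrite linear0 exy.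
by apply/esym/subr0_eq/incl_inj; rewrite linear0.
Qed.

Lemma compl_proj_eq (z : Xi) (a : g) (x : h) :
  z = incl a + incl x -> compl_projg z = a /\ compl_projh z = x.
Proof. by move=> e; apply: compl_inj; rewrite -compl_projE. Qed.

Fact compl_proj_linear (c : k) (u v : Xi) :
  compl_projg (c *: u + v) = c *: compl_projg u + compl_projg v
  /\ compl_projh (c *: u + v) = c *: compl_projh u + compl_projh v.
Proof.
apply: compl_proj_eq.
by rewrite {1}(compl_projE u) {1}(compl_projE v) !linearP addrACA -scalerDr.
Qed.

Definition canonical_lact (x : h) (a : g) : g :=
  compl_projg [lie incl x, incl a].
Definition canonical_ract (x : h) (a : g) : h :=
  compl_projh [lie incl x, incl a].

Lemma canonical_actE (x : h) (a : g) :
  [lie incl x, incl a] = incl (canonical_lact x a) + incl (canonical_ract x a).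
Proof. exact: compl_projE. Qed.

Fact canonical_lact_bilinear : bilinear_map canonical_lact.
Proof.
rewrite /canonical_lact; split=> [a c x y|x c a b].
  by rewrite /= linearP lieDlZ (compl_proj_linear _ _ _).1.
by rewrite /= linearP lieDrZ (compl_proj_linear _ _ _).1.
Qed.

Fact canonical_ract_bilinear : bilinear_map canonical_ract.
Proof.
rewrite /canonical_ract; split=> [a c x y|x c a b].
  by rewrite /= linearP lieDlZ (compl_proj_linear _ _ _).2.
by rewrite /= linearP lieDrZ (compl_proj_linear _ _ _).2.
Qed.

Fact canonical_lie_h (x y : h) (a : g) :
  canonical_lact [lie x, y] a =
    canonical_lact x (canonical_lact y a)
    - canonical_lact y (canonical_lact x a)
  /\ canonical_ract [lie x, y] a =
    [lie x, canonical_ract y a] + [lie canonical_ract x a, y]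
    + canonical_ract x (canonical_lact y a)
    - canonical_ract y (canonical_lact x a).
Proof.
apply: compl_proj_eq; rewrite lie_jacobil.
rewrite (canonical_actE y a) (canonical_actE x a) !lieDr !canonical_actE.
rewrite [[lie canonical_ract x a, y]]lieC !(linearB, linearD) /= !incl_lie.
by rewrite [LHS](AC (3*3) ((1*4)*(3*6*2*5))).
Qed.

Fact canonical_lie_g (x : h) (a b : g) :
  canonical_lact x [lie a, b] =
    [lie canonical_lact x a, b] + [lie a, canonical_lact x b]
    + canonical_lact (canonical_ract x a) b
    - canonical_lact (canonical_ract x b) a
  /\ canonical_ract x [lie a, b] =
    canonical_ract (canonical_ract x a) b
    - canonical_ract (canonical_ract x b) a.
Proof.
apply: compl_proj_eq; rewrite lie_jacobir.
rewrite (canonical_actE x a) (canonical_actE x b) !lieDl !canonical_actE.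
rewrite [[lie a, canonical_lact x b]]lieC !(linearB, linearD) /= !incl_lie.
by rewrite [LHS](AC ((1*2)*(1*2)) ((1*4*2*5)*(3*6))).
Qed.

Definition canonical_matched_pair : matched_pair g h :=
  MatchedPair canonical_lact_bilinear canonical_ract_bilinear
    (fun x y a => (canonical_lie_h x y a).1)
    (fun x a b => (canonical_lie_g x a b).2)
    (fun x a b => (canonical_lie_g x a b).1)
    (fun x y a => (canonical_lie_h x y a).2).

End CanonicalMatchedPair.

Definition deformation_map (k : comPzRingType) (g h : lieAlgType k)
    (mp : matched_pair g h) (r : {linear h -> g}) : Prop :=
  forall x y : h,
    r [lie x, y] - [lie r x, r y] =
      r (ract mp y (r x) - ract mp x (r y)) + lact mp x (r y) - lact mp y (r x).

Definition deformed_bracket (k : comPzRingType) (g h : lieAlgType k)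
    (mp : matched_pair g h) (r : h -> g) (x y : h) : h :=
  [lie x, y] + ract mp x (r y) - ract mp y (r x).

Section Graph.
Variables (k : comPzRingType) (Xi : lieAlgType k) (g h : lieSubalg Xi).
Variable r : {linear h -> g}.

Definition graph_map (x : h) : Xi := incl (r x) + incl x.

Fact graph_map_linear : linear graph_map.
Proof.
move=> c x y; rewrite /graph_map linearP !linearP addrACA.
by rewrite scalerDr.
Qed.
HB.instance Definition _ :=
  GRing.isLinear.Build k h Xi *:%R graph_map graph_map_linear.

End Graph.

(* Main.v *)
Require Import Defs.
From HB Require Import structures.
From mathcomp Require Import all_boot all_algebra.
From mathcomp Require Import boolp classical_sets.
Import GRing.Theory.
Local Open Scope ring_scope.
Local Open Scope classical_set_scope.

(** Everything follows from one identity: the deformation equation for [r] is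
    exactly what makes the graph map [f x = r x + x] multiplicative,
    [f [x, y]_r = [f x, f y]] ([graph_map_deformed_bracket]).  Its component in
    the complement [h] is the definition of the deformed bracket, and its
    component in [g] is the deformation equation.

    The graph map is moreover injective, since [x] is the [h]-component of
    [f x].  Now an injective linear map into a Lie algebra that carries a binary
    operation to the bracket carries all the Lie structure with it: its range is
    a subalgebra ([range_lie_subalgebra]), the operation satisfies the Lie axioms
    because their images do ([lie_bracket_pullback]), and the map is an
    isomorphism onto its range ([lie_isomorphic_range]).  So neither the Jacobi
    identity for the deformed bracket nor the closure of the graph needs a direct
    computation with the matched pair axioms.

    That the graph is again a complement of [g] is linear algebra: shearing by
    [r] turns [z = a + x] into [z = (a - r x) + f x], and an element of the graph
    lying in [g] has a zero [h]-component ([graph_is_complement]). *)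

(** * Transport of Lie structure along an injective linear map *)

Section Transport.
Variables (k : comPzRingType) (V : lmodType k) (L : lieAlgType k).
Variables (f : {linear V -> L}) (br : V -> V -> V).
Hypothesis f_br : forall x y, f (br x y) = [lie f x, f y].

Lemma range_lie_subalgebra : lie_subalgebra (range f).
Proof.
split; [split|].
- by apply/mem_set; exists 0; rewrite ?linear0.
- move=> c _ _ /set_mem[x _ <-] /set_mem[y _ <-]; apply/mem_set.
  by exists (c *: x + y); rewrite ?linearP.
- move=> _ _ /set_mem[x _ <-] /set_mem[y _ <-]; apply/mem_set.
  by exists (br x y); rewrite ?f_br.
Qed.

Hypothesis f_inj : injective f.

(** Each Lie axiom is an equation between expressions in [br] and the module
    operations, hence can be checked after applying [f]. *)
Lemma lie_bracket_pullback : lie_bracket br.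
Proof.
split.
- split=> [z|z] c x y; apply: f_inj.
    by rewrite linearP !f_br linearP lieDlZ.
  by rewrite linearP !f_br linearP lieDrZ.
- by move=> x; apply: f_inj; rewrite linear0 f_br liexx.
- move=> x y z; apply: f_inj; rewrite linear0 !linearD /= !f_br.
  exact: (lie_bracket_jacobi (lie_isbracket L)).
Qed.

Lemma lie_isomorphic_range (brP : lie_bracket br)
    (fP : lie_subalgebra (range f)) :
  lie_isomorphic (lie_on brP) (LieSubalg fP).
Proof.
have fV (x : V) : f x \in range f by apply/mem_set; exists x.
pose F (x : lie_on brP) : LieSubalg fP := Sub (f x) (fV x).
have inclF x : incl (F x) = f x by [].
have F_lin : linear F.
  by move=> c x y; apply: incl_inj; rewrite linearP !inclF linearP.
pose Flin : {linear lie_on brP -> LieSubalg fP} :=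
  HB.pack F (GRing.isLinear.Build k _ _ *:%R F F_lin).
exists Flin; last by move=> x y; apply: incl_inj; rewrite incl_lie /= !inclF f_br.
have /choice[G GK] (y : LieSubalg fP) : exists x : lie_on brP, f x = incl y.
  by have [x _ fx] := inclP y; exists x.
exists G => [x|y]; first by apply: f_inj; rewrite GK.
by apply: incl_inj; rewrite inclF GK.
Qed.

End Transport.

(** * The graph of a deformation map *)

Section DeformationGraph.
Variables (k : comPzRingType) (Xi : lieAlgType k) (g h : lieSubalg Xi).
Hypothesis gh : is_complement g h.
Variable r : {linear h -> g}.

Lemma graph_map_inj : injective (graph_map r).
Proof. by move=> x y /(compl_inj gh)[]. Qed.

Lemma graph_is_complement (grP : lie_subalgebra (range (graph_map r))) :
  is_complement g (LieSubalg grP).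
Proof.
split=> [z|].
  have [a [x ->]] := gh.1 z.
  have fx : graph_map r x \in range (graph_map r) by apply/mem_set; exists x.
  pose y : LieSubalg grP := Sub (graph_map r x) fx.
  have y_graph : incl y = graph_map r x by [].
  by exists (a - r x), y; rewrite y_graph /graph_map linearB addrA subrK.
apply/seteqP; split=> [z [gz [x _ fx]] /=|_ ->]; last first.
  split; last by exists 0; rewrite ?linear0.
  by rewrite -(linear0 (@incl k Xi g)); exact: inclP.
pose a : g := Sub z (mem_set gz).
have : incl (r x) + incl x = incl a + incl (0 : h) by rewrite linear0 addr0.
by move=> /(compl_inj gh)[_ x0]; rewrite -fx x0 linear0.
Qed.

(** Writing [x |> a] and [x <| a] for the [g]- and [h]-components of the
    bracket of [x] in [h] with [a] in [g], the expansion of the bracket of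
    [r x + x] with [r y + y] has [h]-component the deformed bracket of [x] and
    [y], and [g]-component [[lie r x, r y] + x |> r y - y |> r x].  The
    deformation equation says that the latter is [r] of the former. *)
Lemma graph_map_deformed_bracket :
  deformation_map (canonical_matched_pair gh) r ->
  forall x y,
    graph_map r (deformed_bracket (canonical_matched_pair gh) r x y)
    = [lie graph_map r x, graph_map r y].
Proof.
move=> hr x y; have := hr x y; rewrite /graph_map /deformed_bracket /=.
set xy := canonical_ract gh x (r y); set yx := canonical_ract gh y (r x).
set lxy := canonical_lact gh x (r y); set lyx := canonical_lact gh y (r x).
move=> /eqP; rewrite subr_eq => /eqP r_lie.
have -> : r ([lie x, y] + xy - yx) = [lie r x, r y] + lxy - lyx.
  rewrite -addrA -[xy - yx]opprB linearB /= r_lie.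
  by rewrite [LHS](ACl (4*2*3*1*5)) /= addrK.
rewrite lieDl !lieDr [[lie incl (r x), incl y]]lieC !(canonical_actE gh) opprD.
rewrite -/xy -/yx -/lxy -/lyx !(linearB, linearD) /= !incl_lie.
by rewrite [RHS](AC ((1*2)*(2*1)) ((1*4*2)*(6*5*3))).
Qed.

End DeformationGraph.

Theorem theorem4p2 (k : comPzRingType) (Xi : lieAlgType k)
    (g h : lieSubalg Xi) (gh : is_complement g h) (r : {linear h -> g})
    (hr : deformation_map (canonical_matched_pair gh) r) :
  exists htP : lie_subalgebra (range (graph_map r)),
    is_complement g (LieSubalg htP)
    /\ exists brP : lie_bracket (deformed_bracket (canonical_matched_pair gh) r),
         lie_isomorphic (lie_on brP) (LieSubalg htP).
Proof.
have f_br := graph_map_deformed_bracket _ _ _ _ gh r hr.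
have f_inj := graph_map_inj _ _ _ _ gh r.
exists (range_lie_subalgebra _ _ _ _ _ f_br); split.
  exact: graph_is_complement.
exists (lie_bracket_pullback _ _ _ _ _ f_br f_inj).
exact: lie_isomorphic_range.
Qed.
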